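(* Let $d\ge1$ be an integer. (a) The canonical translation flow of $\mathbb R^d$, i.e. the $\mathbb R^d$-flow $\tau_s(z,t)=(z,t+s)$ on $[0,1]\times\mathbb R^d$ equipped with the product of Lebesgue measures, is factor-universal: every nonsingular $\mathbb R^d$-flow is a factor of it. (b) The ergodic dissipative $\mathbb R^d$-flow, i.e. the translation flow $\tau_s(t)=t+s$ on $\mathbb R^d$ equipped with Lebesgue measure, is a factor of every totally dissipative nonsingular $\mathbb R^d$-flow on a non-atomic measure space.
   Context: All measure spaces are standard $\sigma$-finite measure spaces with nonzero measure; $\sim$ means having the same null sets. A (nonsingular) $\mathbb R^d$-flow on $(\Omega,\mathcal F,\mu)$ is a nonsingular (jointly measurable) action of $\mathbb R^d$: a homomorphism $s\mapsto\phi_s$ from $\mathbb R^d$ to the group of invertible bimeasurable maps $R$ of $\Omega$ with $\mu\circ R^{-1}\sim\mu$. An $\mathbb R^d$-flow $(\Omega',\mathcal F',\mu',(\psi_s))$ is a factor of $(\Omega,\mathcal F,\mu,(\phi_s))$ if there is a measurable $\pi:\Omega\to\Omega'$ such that $\mu$-almost everywhere, for all $s\in\mathbb R^d$, $\pi\circ\phi_s=\psi_s\circ\pi$, and $\mu\circ\pi^{-1}\sim\mu'$. A nonsingular action of a countable group $G$ is totally dissipative if there is a measurable set $W$ whose translates by distinct elements of $G$ are pairwise disjoint and cover the space modulo a null set. An $\mathbb R^d$-flow $(\phi_t)$ is totally dissipative if for every $s>0$ the $\mathbb Z^d$-action $(\phi_{sn})_{n\in\mathbb Z^d}$ is totally dissipative.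 *)

(* Defs.v *)
From HB Require Import structures.
From mathcomp Require Import all_boot all_order all_algebra.
From mathcomp Require Import all_classical all_reals all_analysis.

Set Implicit Arguments.
Unset Strict Implicit.
Unset Printing Implicit Defensive.
Import Order.TTheory GRing.Theory Num.Theory.
Import numFieldNormedType.Exports.

Local Open Scope classical_set_scope.
Local Open Scope ring_scope.

(* R^n is 'rV[R]_n with the sigma-algebra generated by the coordinates, i.e.
   its Borel sigma-algebra; this mirrors the library instance on n.-tuple T. *)
Definition rV_display : measure_display.
Proof. exact: default_measure_display. Qed.

Section measurable_rV.
Context {R : realType} (n : nat).

Let coord : 'I_n -> 'rV[R]_n -> R := fun i v => v ord0 i.

Let rV_set0 : g_sigma_preimage coord set0.
Proof. exact: sigma_algebra0. Qed.

Let rV_setC A : g_sigma_preimage coord A -> g_sigma_preimage coord (~` A).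
Proof. exact: sigma_algebraC. Qed.

Let rV_bigcup (F : _^nat) : (forall i, g_sigma_preimage coord (F i)) ->
  g_sigma_preimage coord (\bigcup_i (F i)).
Proof. exact: sigma_algebra_bigcup. Qed.

HB.instance Definition _ := @isMeasurable.Build rV_display
  'rV[R]_n (g_sigma_preimage coord) rV_set0 rV_setC rV_bigcup.

End measurable_rV.

Section measurable_rV_lemmas.
Context {R : realType}.

Lemma measurable_coord n (i : 'I_n) :
  measurable_fun setT (fun v : 'rV[R]_n => v ord0 i).
Proof.
move=> _ Y mY; rewrite setTI; apply: sub_sigma_algebra => /=.
rewrite -bigcup_seq/=; exists i => /=; first by rewrite mem_index_enum.
by exists Y => //; rewrite setTI.
Qed.

Lemma measurable_fun_rVP d (T : measurableType d) n (f : T -> 'rV[R]_n) :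
  measurable_fun setT f <->
  forall i, measurable_fun setT (fun x => f x ord0 i).
Proof.
split=> [mf i|mf]; first exact: (measurableT_comp (measurable_coord i)).
move=> _ Y mY; rewrite setTI.
suff: measurable `<=` [set Z : set 'rV[R]_n | measurable (f @^-1` Z)] by exact.
apply: smallest_sub => /=.
  split => /= [|A mA|F mF].
  - by rewrite preimage_set0.
  - by rewrite setTD preimage_setC; exact: measurableC.
  - by rewrite preimage_bigcup; exact: bigcup_measurable.
rewrite -bigcup_seq/= => A [i /= _ [B mB <-]]; rewrite setTI.
by have := mf i measurableT _ mB; rewrite setTI.
Qed.

Lemma measurable_rVD n d (T : measurableType d) (f g : T -> 'rV[R]_n) :
  measurable_fun setT f -> measurable_fun setT g ->
  measurable_fun setT (fun x => f x + g x).
Proof.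
move=> /measurable_fun_rVP mf /measurable_fun_rVP mg.
apply/measurable_fun_rVP => i; under eq_fun do rewrite mxE.
exact: measurable_realfun.measurable_funD.
Qed.

End measurable_rV_lemmas.

(* Lebesgue measure on R^n: Dirac mass on R^0 = {0}, and on R^(n+1) the product
   of the one-dimensional Lebesgue measure and the Lebesgue measure on R^n. *)
Section lebesgue_rV_step.
Context {R : realType} (n : nat).

Definition cons_rV (p : measurableTypeR R * 'rV[R]_n) : 'rV[R]_n.+1 :=
  \row_i (if unlift ord0 i is Some j then p.2 ord0 j else p.1).

Lemma measurable_cons_rV : measurable_fun setT cons_rV.
Proof.
apply/measurable_fun_rVP => i; rewrite /cons_rV.
under eq_fun do rewrite mxE.
case: unliftP => [j _|_]; last exact: measurable_fst.
exact: (measurableT_comp (measurable_coord j)).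
Qed.

Definition uncons_rV (v : 'rV[R]_n.+1) : measurableTypeR R * 'rV[R]_n :=
  (v ord0 ord0, \row_j v ord0 (lift ord0 j)).

Lemma measurable_uncons_rV : measurable_fun setT uncons_rV.
Proof.
apply: measurable_fun_pair; first exact: measurable_coord.
apply/measurable_fun_rVP => i; under eq_fun do rewrite mxE.
exact: measurable_coord.
Qed.

Lemma cons_rVK : cancel cons_rV uncons_rV.
Proof.
move=> [x v]; rewrite /uncons_rV /cons_rV mxE unlift_none/=; congr pair.
by apply/rowP => j; rewrite !mxE liftK.
Qed.

Lemma uncons_rVK : cancel uncons_rV cons_rV.
Proof.
move=> v; apply/rowP => i; rewrite !mxE/=.
by case: unliftP => [j ->|->]; rewrite ?mxE.
Qed.

Variable mu : {sigma_finite_measure set 'rV[R]_n -> \bar R}.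

Definition lebesgue_rV_step (A : set 'rV[R]_n.+1) : \bar R :=
  pushforward (lebesgue_measure \x mu)%E cons_rV A.

Let step0 : lebesgue_rV_step set0 = 0%E.
Proof. by rewrite /lebesgue_rV_step /pushforward preimage_set0 measure0. Qed.

Let step_ge0 A : (0 <= lebesgue_rV_step A)%E.
Proof. have mf := measurable_cons_rV; exact: measure_ge0. Qed.

Let step_sigma_additive : semi_sigma_additive lebesgue_rV_step.
Proof.
have mf := measurable_cons_rV; exact: measure_semi_sigma_additive.
Qed.

HB.instance Definition _ := isMeasure.Build _ _ _ lebesgue_rV_step
  step0 step_ge0 step_sigma_additive.

Let step_sigma_finite : sigma_finite setT lebesgue_rV_step.
Proof.
have [F FT Foo] : sigma_finite setT (lebesgue_measure \x mu)%E.
  exact: (@isSigmaFinite.sigma_finiteT _ _ _ _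
    (lebesgue_integral_fubini.measure_function_Measure_isSigmaFinite__to__measure_function_isSigmaFinite
       lebesgue_measure mu)).
exists (fun k => uncons_rV @^-1` F k).
  by rewrite -preimage_bigcup -FT preimage_setT.
move=> k; have [mF Fk] := Foo k; split.
  by rewrite -[X in measurable X]setTI; exact: measurable_uncons_rV.
rewrite /lebesgue_rV_step /pushforward -comp_preimage.
rewrite (_ : uncons_rV \o cons_rV = idfun)//.
by apply/funext => p /=; rewrite cons_rVK.
Qed.

HB.instance Definition _ := Measure_isSigmaFinite.Build _ _ _
  lebesgue_rV_step step_sigma_finite.

End lebesgue_rV_step.

Fixpoint lebesgue_rV {R : realType} (n : nat) :
    {sigma_finite_measure set 'rV[R]_n -> \bar R} :=
  match n with
  | 0 => \d_ (0 : 'rV[R]_0)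
  | m.+1 => lebesgue_rV_step (lebesgue_rV m)
  end.

Section lebesgue_rV_lemmas.
Context {R : realType}.
Local Open Scope ereal_scope.

Lemma lebesgue_rV_box n (I : 'I_n -> set R) : (forall i, measurable (I i)) ->
  lebesgue_rV n [set v : 'rV[R]_n | forall i, I i (v ord0 i)] =
  \prod_(i < n) lebesgue_measure (I i).
Proof.
elim: n I => [|n IH] I mI.
  by rewrite big_ord0 /= diracE mem_set // => -[].
transitivity (lebesgue_measure (I ord0) *
  \prod_(i < n) lebesgue_measure (I (lift ord0 i))); last first.
  exact/esym/big_ord_recl.
rewrite -IH; last by move=> i; exact: mI.
rewrite /= /lebesgue_rV_step /pushforward -product_measure1E; [|exact: mI|]; last first.
  rewrite (_ : [set _ | _] = \big[setI/setT]_(i < n)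
    ((fun v : 'rV[R]_n => v ord0 i) @^-1` I (lift ord0 i))).
    apply: bigsetI_measurable => i _.
    by rewrite -[X in measurable X]setTI; exact: measurable_coord.
  by rewrite -bigcap_seq; apply/seteqP; split => v /= Iv i;
    [move=> _; exact: Iv|apply: Iv; rewrite /= mem_index_enum].
congr (_ _); apply/seteqP; split => -[x v] /=.
  move=> Iv; split; first by have := Iv ord0; rewrite mxE unlift_none.
  by move=> i; have := Iv (lift ord0 i); rewrite mxE liftK.
by move=> [Ix Iv] i; rewrite mxE; case: unliftP => [j ->|->] //=; exact: Iv.
Qed.

Lemma lebesgue_measureD (s : R) (A : set R) : measurable A ->
  lebesgue_measure ((fun x => x + s)%R @^-1` A) = lebesgue_measure A.
Proof.
move=> mA.
have ms : measurable_fun setT ((fun x => x + s)%R : R -> measurableTypeR R).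
  exact: measurable_realfun.measurable_funD.
apply/esym.
apply: (@lebesgue_measure_unique R
  (measure_function_pushforward__canonical__measure_function_Measure
     lebesgue_measure ms)) => // _ [[a b]] _ <- /=.
rewrite /pushforward.
rewrite (_ : _ @^-1` _ = [set` `](a - s)%R, (b - s)%R]]); last first.
  by apply/seteqP; split => x /=; rewrite !in_itv/= ltrBlDr lerBrDr.
rewrite !lebesgue_measure_itv/= !lte_fin ltrD2r.
by rewrite -!EFinB opprB addrA subrK.
Qed.

Lemma lebesgue_rVD n (s : 'rV[R]_n) (A : set 'rV[R]_n) : measurable A ->
  lebesgue_rV n ((fun t => t + s)%R @^-1` A) = lebesgue_rV n A.
Proof.
elim: n s A => [|n IH] s A mA.
  by congr (_ _); apply/seteqP; split => t /=; rewrite !thinmx0.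
rewrite /= /lebesgue_rV_step /pushforward.
pose f (p : measurableTypeR R * 'rV[R]_n) : measurableTypeR R * 'rV[R]_n :=
  (p.1 + s ord0 ord0, p.2 + \row_j s ord0 (lift ord0 j))%R.
have mf1 : measurable_fun setT
    ((fun x => x + s ord0 ord0)%R : measurableTypeR R -> measurableTypeR R).
  exact: measurable_realfun.measurable_funD.
have mf2 : measurable_fun setT
    (fun v : 'rV[R]_n => v + \row_j s ord0 (lift ord0 j))%R.
  exact: measurable_rVD.
have mf : measurable_fun setT f.
  by apply: measurable_fun_pair; [exact: (measurableT_comp mf1)|
                                  exact: (measurableT_comp mf2)].
have -> : @cons_rV R n @^-1` ((fun t => t + s)%R @^-1` A) =
    f @^-1` (@cons_rV R n @^-1` A).
  apply/seteqP; split => p /=; rewrite (_ : cons_rV (f p) = cons_rV p + s)%R//;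
    apply/rowP => i; rewrite !mxE/=;
    by case: unliftP => [j ->|->]; rewrite ?mxE.
apply/esym; apply: (@product_measure_unique _ _ _ _ _ lebesgue_measure
  (lebesgue_rV n)
  (measure_function_pushforward__canonical__measure_function_Measure
    (lebesgue_measure \x lebesgue_rV n) mf)) => [B C mB mC|].
  rewrite /= /pushforward.
  rewrite (_ : f @^-1` _ = ((fun x => x + s ord0 ord0)%R @^-1` B) `*`
      ((fun v => v + \row_j s ord0 (lift ord0 j))%R @^-1` C))//.
  rewrite product_measure1E//.
  - by congr (_ * _); [exact: lebesgue_measureD|exact: IH].
  - by rewrite -[X in measurable X]setTI; exact: mf1.
  - by rewrite -[X in measurable X]setTI; exact: mf2.
by rewrite -[X in measurable X]setTI; exact: measurable_cons_rV.
Qed.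

End lebesgue_rV_lemmas.

Section unit_interval.
Context {R : realType}.

Definition unit_sig : Type := {x : R | 0 <= x <= 1}.

Fact unit_sig0 : 0 <= (0 : R) <= 1. Proof. by rewrite lexx ler01. Qed.

HB.instance Definition _ := Choice.on unit_sig.
HB.instance Definition _ := isPointed.Build unit_sig (exist _ 0 unit_sig0).

Definition unit_val (x : unit_sig) : measurableTypeR R := sval x.

Definition unit_itv := g_sigma_algebra_preimageType unit_val.

Definition lebesgue_unit (A : set unit_itv) : \bar R :=
  lebesgue_measure (unit_val @` A).

Lemma measurable_unit_val_image (A : set unit_itv) : measurable A ->
  measurable (unit_val @` A).
Proof.
move=> [B mB <-]; rewrite setTI (_ : _ @` _ = B `&` [set` `[0%R, 1%R]]).
  by apply: measurableI => //; exact: measurable_itv.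
apply/seteqP; split => [_ [[x x01] Bx <-]|x [Bx]] /=; rewrite in_itv/= => //.
by move=> x01; exists (exist _ x x01).
Qed.

Let unit0 : lebesgue_unit set0 = 0%E.
Proof. by rewrite /lebesgue_unit image_set0 measure0. Qed.

Let unit_ge0 A : (0 <= lebesgue_unit A)%E.
Proof. exact: measure_ge0. Qed.

Let unit_sigma_additive : semi_sigma_additive lebesgue_unit.
Proof.
move=> F mF tF mUF; rewrite /lebesgue_unit image_bigcup.
apply: measure_semi_sigma_additive.
- by move=> i; exact: measurable_unit_val_image.
- move=> i j _ _ [_ [[x Fix <-] [y Fjy /val_inj yx]]].
  by apply: tF => //; exists x; split=> //; rewrite -yx.
- by rewrite -image_bigcup; exact: measurable_unit_val_image.
Qed.

HB.instance Definition _ := isMeasure.Build _ _ _ lebesgue_unit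
  unit0 unit_ge0 unit_sigma_additive.

End unit_interval.
Arguments unit_itv : clear implicits.

Section nonsingular_flows.
Context {R : realType}.

Definition null_equiv d (T : measurableType d) (mu nu : set T -> \bar R) :=
  forall A, measurable A -> mu A = 0%E <-> nu A = 0%E.

Definition nonsingular d (T : measurableType d) (mu : set T -> \bar R)
    (f : T -> T) : Prop :=
  [/\ bijective f,
      measurable_fun setT f,
      (forall A, measurable A -> measurable (f @` A)) &
      null_equiv (pushforward mu f) mu].

(* [flow_mapD] and bijectivity together give [flow_map 0 = id]. *)
Record nsflow (n : nat) d (T : measurableType d) (mu : set T -> \bar R) :=
  NSFlow {
    flow_map :> 'rV[R]_n -> T -> T;
    flow_mapD : forall s t x, flow_map (s + t) x = flow_map s (flow_map t x);
    flow_nonsingular : forall s, nonsingular mu (flow_map s);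
    flow_measurable :
      measurable_fun setT (fun p : 'rV[R]_n * T => flow_map p.1 p.2) }.

(* [is_factor psi phi]: psi is a factor of phi. *)
Definition is_factor n d d' (T : measurableType d) (T' : measurableType d')
    (mu : {measure set T -> \bar R}) (nu : {measure set T' -> \bar R})
    (psi : nsflow n nu) (phi : nsflow n mu) : Prop :=
  exists pi : T -> T',
    [/\ measurable_fun setT pi,
        {ae mu, forall x, forall s, pi (phi s x) = psi s (pi x)} &
        null_equiv (pushforward mu pi) nu].

(* G is the acting countable group; the wandering-set condition only refers to
   its elements, not to its law. *)
Definition totally_dissipative_action d (T : measurableType d)
    (mu : set T -> \bar R) (G : countType) (a : G -> T -> T) : Prop :=
  exists W : set T,
    [/\ measurable W,
        (forall g h, g != h -> (a g @` W) `&` (a h @` W) = set0) &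
        mu (~` \bigcup_g (a g @` W)) = 0%E].

Definition totally_dissipative n d (T : measurableType d)
    (mu : set T -> \bar R) (phi : nsflow n mu) : Prop :=
  forall s : R, 0 < s -> totally_dissipative_action mu
    (fun m : 'rV[int]_n => phi (s *: map_mx intr m)).

(* T carries the Borel sigma-algebra of a Polish topology, that of P transported
   along the bijection f; a Hausdorff pseudometric is a metric, and for metric
   spaces second countable means separable. *)
Definition standard_space d (T : measurableType d) : Prop :=
  exists (P : completePseudoMetricType R) (f : T -> P),
    [/\ hausdorff_space P, @second_countable P, bijective f &
        @measurable d T = preimage_set_system setT f <<s @open P >>].

Definition nonatomic d (T : measurableType d) (mu : set T -> \bar R) : Prop :=
  forall A, measurable A -> (0 < mu A)%E ->
    exists B, [/\ measurable B, B `<=` A & (0 < mu B < mu A)%E].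

Lemma invariant_nonsingular n d (T : measurableType d) (mu : set T -> \bar R)
    (f : 'rV[R]_n -> T -> T) :
  (forall x, f 0 x = x) ->
  (forall s t x, f (s + t) x = f s (f t x)) ->
  (forall s, measurable_fun setT (f s)) ->
  (forall s A, measurable A -> mu (f s @^-1` A) = mu A) ->
  forall s, nonsingular mu (f s).
Proof.
move=> f0 fD mf fmu s.
have fK r : cancel (f r) (f (- r)) by move=> x; rewrite -fD addNr f0.
have fNK r : cancel (f (- r)) (f r) by move=> x; rewrite -fD subrr f0.
split; [by exists (f (- s))|exact: mf| |by move=> A mA; rewrite /pushforward fmu].
move=> A mA; rewrite (_ : _ @` A = f (- s) @^-1` A); last first.
  apply/seteqP; split => [_ [x Ax <-]|x Ax] /=; first by rewrite fK.
  by exists (f (- s) x) => //; exact: fNK.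
by rewrite -[X in measurable X]setTI; exact: mf.
Qed.

End nonsingular_flows.
Arguments standard_space R {d} T.

Section translation_flows.
Context {R : realType} (n : nat).

Definition translation (s t : 'rV[R]_n) : 'rV[R]_n := t + s.

Let translationD s t x : translation (s + t) x = translation s (translation t x).
Proof. by rewrite /translation addrA addrAC. Qed.

Let measurable_translation s : measurable_fun setT (translation s).
Proof. by rewrite /translation; exact: measurable_rVD. Qed.

Let translation_nonsingular s : nonsingular (lebesgue_rV n) (translation s).
Proof.
apply: invariant_nonsingular => [x| | |r A mA].
- by rewrite /translation addr0.
- exact: translationD.
- exact: measurable_translation.
- exact: lebesgue_rVD.
Qed.

Let translation_measurable :
  measurable_fun setT (fun p : 'rV[R]_n * 'rV[R]_n => translation p.1 p.2).
Proof. by rewrite /translation; exact: measurable_rVD. Qed.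

Definition translation_flow : nsflow n (lebesgue_rV n) :=
  NSFlow translationD translation_nonsingular translation_measurable.

Definition canonical_translation (s : 'rV[R]_n)
    (p : unit_itv R * 'rV[R]_n) : unit_itv R * 'rV[R]_n := (p.1, p.2 + s).

Let canonicalD s t p : canonical_translation (s + t) p =
  canonical_translation s (canonical_translation t p).
Proof. by rewrite /canonical_translation/= addrA addrAC. Qed.

Let canonical_measurable : measurable_fun setT
  (fun p : 'rV[R]_n * (unit_itv R * 'rV[R]_n) =>
     canonical_translation p.1 p.2).
Proof.
apply: measurable_fun_pair; first exact: measurableT_comp.
by apply: measurable_rVD => //; exact: measurableT_comp.
Qed.

Let measurable_canonical s : measurable_fun setT (canonical_translation s).
Proof.
apply: measurable_fun_pair => //.
exact: measurable_rVD.
Qed.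

Let canonical_nonsingular s :
  nonsingular (lebesgue_unit \x lebesgue_rV n)%E (canonical_translation s).
Proof.
apply: invariant_nonsingular => [[z x]| | |r A mA].
- by rewrite /canonical_translation/= addr0.
- exact: canonicalD.
- exact: measurable_canonical.
- apply: eq_integral => z _ /=.
  rewrite -[RHS](lebesgue_rVD r); last exact: (measurable_xsection _ mA).
  by congr (lebesgue_rV n _); apply/seteqP; split => t /=;
    rewrite /xsection/= !inE.
Qed.

Definition canonical_translation_flow :
    nsflow n (lebesgue_unit \x lebesgue_rV n)%E :=
  NSFlow canonicalD canonical_nonsingular canonical_measurable.

End translation_flows.
Arguments translation_flow : clear implicits.
Arguments canonical_translation_flow : clear implicits.

(* Main.v *)
(* (a) Choose h : [0,1] -> T carrying Lebesgue measure to a measure equivalent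
   to mu, and map (z, t) to phi_t (h z).  Such an h is a quantile function
   followed by a Borel left inverse of an injective real coding of T.
   By Fubini and nonsingularity, A is mu-null iff for mu-almost every x the set
   of times t with phi_t x in A is Lebesgue-null, which identifies null sets.
   (b) If W is wandering for the action of Z^d, then for almost every x the set
   V_x = {t | phi_t x in W} is a fundamental domain of Z^d in R^d modulo null
   sets, hence has positive finite measure, and V_(phi_s x) = V_x - s.  The
   coordinatewise median of -t for Lebesgue measure on V_x is an equivariant
   map to R^d, and the same Fubini argument shows that it carries mu to a
   measure equivalent to Lebesgue measure. *)
Require Import Defs.
From mathcomp Require Import all_boot all_order all_algebra.
From mathcomp Require Import all_classical all_reals all_analysis.
From mathcomp Require Import measurable_realfun.
From mathcomp Require Import lra.

Set Implicit Arguments.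
Unset Strict Implicit.
Unset Printing Implicit Defensive.
Import Order.TTheory GRing.Theory Num.Theory.
Import numFieldNormedType.Exports.

Local Open Scope classical_set_scope.
Local Open Scope ring_scope.

(** * Null sets of products and monotone limits of measures *)

Section null_sets.
Context {R : realType}.
Local Open Scope ereal_scope.

Lemma measurable_set_cst d (T : measurableType d) (Q : Prop) :
  measurable [set _ : T | Q].
Proof.
have [q|q] := pselect Q.
  by rewrite (_ : [set _ | _] = setT)//; apply/seteqP; split.
by rewrite (_ : [set _ | _] = set0)//; apply/seteqP; split.
Qed.

Lemma integral_eq0P d (T : measurableType d) (mu : {measure set T -> \bar R})
    (f : T -> \bar R) : measurable_fun setT f -> (forall x, 0 <= f x) ->
  \int[mu]_x f x = 0 <-> mu [set x | f x <> 0] = 0.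
Proof.
move=> mf f0.
have -> : \int[mu]_x f x = \int[mu]_x `|f x|.
  by apply: eq_integral => x _; rewrite gee0_abs.
have mN : measurable [set x | f x <> 0].
  rewrite (_ : [set x | _] = setT `&` [set x | f x != 0]).
    exact: emeasurable_neq.
  by rewrite setTI; apply/seteqP; split => x /eqP.
rewrite (ae_eq_integral_abs mu measurableT mf); split => [[N [mN' N0 sN]]|f00].
  apply: (subset_measure0 mN mN' _ N0) => x fx; apply: sN => /=.
  by move/(_ I).
exists [set x | f x <> 0]; split => // x /= H fx; apply: H => _.
by rewrite fx.
Qed.

(** Both sides say that the product measure of [B] vanishes: the two iterated integrals agree by
    uniqueness of the product of sigma-finite measures. *)
Lemma product_measureC_eq0 d1 d2 (T1 : measurableType d1)
    (T2 : measurableType d2) (m1 : {sigma_finite_measure set T1 -> \bar R})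
    (m2 : {sigma_finite_measure set T2 -> \bar R}) (B : set (T1 * T2)) :
  measurable B ->
  m1 [set x | m2 (xsection B x) <> 0] = 0 <->
  m2 [set y | m1 (ysection B y) <> 0] = 0.
Proof.
move=> mB.
have E : (m1 \x m2) B = (m1 \x^ m2) B.
  by apply: product_measure_unique => // *; rewrite /= product_measure2E.
rewrite -(@integral_eq0P _ _ m1 (m2 \o xsection B)) //; last first.
  by apply: measurable_fun_xsection.
rewrite -(@integral_eq0P _ _ m2 (m1 \o ysection B)) //; last first.
  by apply: measurable_fun_ysection.
by move: E; rewrite /product_measure1 /product_measure2 => ->.
Qed.

Lemma measure_bigcup_le d (T : measurableType d)
    (mu : {measure set T -> \bar R}) (F : (set T)^nat) (c : \bar R) :
  (forall k, measurable (F k)) -> nondecreasing_seq F ->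
  (forall k, mu (F k) <= c) -> mu (\bigcup_k F k) <= c.
Proof.
move=> mF ndF Fc.
have cF := nondecreasing_cvg_mu (mu := mu) mF (bigcupT_measurable _ mF) ndF.
rewrite -(cvg_lim _ cF)//; apply: lime_le; last exact: nearW.
by apply/cvg_ex; eexists; exact: cF.
Qed.

Lemma le_measure_bigcap d (T : measurableType d)
    (mu : {measure set T -> \bar R}) (F : (set T)^nat) (c : \bar R) :
  (forall k, measurable (F k)) -> nonincreasing_seq F -> mu (F 0%N) < +oo ->
  (forall k, c <= mu (F k)) -> c <= mu (\bigcap_k F k).
Proof.
move=> mF niF F0 Fc.
have cF := nonincreasing_cvg_mu (mu := mu) F0 mF (bigcapT_measurable mF) niF.
rewrite -(cvg_lim _ cF)//; apply: lime_ge; last exact: nearW.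
by apply/cvg_ex; eexists; exact: cF.
Qed.

End null_sets.

Section unit_cube.
Context {R : realType} (n : nat).

Definition unit_cube : set 'rV[R]_n :=
  [set v | forall i, (`[0, 1[%classic : set R) (v ord0 i)].

Lemma measurable_unit_cube : measurable unit_cube.
Proof.
rewrite (_ : unit_cube = \big[setI/setT]_(i < n)
    ((fun v : 'rV[R]_n => v ord0 i) @^-1` `[0%R, 1%R[%classic)).
  apply: bigsetI_measurable => i _.
  rewrite -[X in measurable X]setTI.
  by apply: (@measurable_coord R n i measurableT); exact: measurable_itv.
by rewrite -bigcap_seq; apply/seteqP; split => v /= Iv i;
  [move=> _; exact: Iv|apply: Iv; rewrite /= mem_index_enum].
Qed.

Lemma lebesgue_unit_cube : lebesgue_rV n unit_cube = 1%E.
Proof.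
rewrite (lebesgue_rV_box (I := fun=> `[0%R, 1%R[%classic)) => [|i].
  rewrite big1// => i _.
  by rewrite lebesgue_measure_itv/= lte_fin ltr01 oppr0 adde0.
exact: measurable_itv.
Qed.

Lemma lebesgue_rVT_neq0 : lebesgue_rV n [set: 'rV[R]_n] <> 0%E.
Proof.
move=> T0; have := lebesgue_unit_cube.
rewrite (subset_measure0 measurable_unit_cube measurableT _ T0)//.
by move=> /eqP; rewrite eq_sym onee_eq0.
Qed.

End unit_cube.

(** * Fubini along the orbits of a flow *)

Section flow_null_sets.
Context {R : realType} (n : nat) d (T : measurableType d).
Variables (mu : {sigma_finite_measure set T -> \bar R}) (phi : nsflow n mu).
Local Open Scope ereal_scope.

Lemma measurable_orbit (x : T) : measurable_fun setT (fun t => phi t x).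
Proof.
have mx : measurable_fun setT (fun t : 'rV[R]_n => (t, x)).
  exact: measurable_fun_pair.
exact: (measurableT_comp (flow_measurable phi) mx).
Qed.

Lemma measurable_flow_swap :
  measurable_fun setT (fun p : T * 'rV[R]_n => phi p.2 p.1).
Proof.
have ms : measurable_fun setT (fun p : T * 'rV[R]_n => (p.2, p.1)).
  exact: measurable_fun_pair.
exact: (measurableT_comp (flow_measurable phi) ms).
Qed.

(** The constraint [B] on the times serves the half-spaces that enter the definition of medians. *)
Lemma measurable_lebesgue_orbit_set (A : set T) (B : set 'rV[R]_n) :
  measurable A -> measurable B ->
  measurable_fun setT
    (fun x => lebesgue_rV n [set t | A (phi t x) /\ B t]).
Proof.
move=> mA mB.
pose C := [set p : T * 'rV[R]_n | A (phi p.2 p.1) /\ B p.2].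
have mC : measurable C.
  apply: measurableI.
    rewrite -[X in measurable X]setTI.
    exact: measurable_flow_swap.
  by rewrite -[X in measurable X]setTI; exact: measurable_snd.
apply: (eq_measurable_fun (lebesgue_rV n \o xsection C)).
  by move=> x _ /=; congr (lebesgue_rV n _); rewrite xsectionE.
exact: measurable_fun_xsection.
Qed.

(* Fubini on [T * R^n]: each [phi t] preserves null sets. *)
Lemma flow_null (A : set T) : measurable A ->
  mu A = 0 <-> mu [set x | lebesgue_rV n [set t | A (phi t x)] <> 0] = 0.
Proof.
move=> mA; pose C := [set p : T * 'rV[R]_n | A (phi p.2 p.1)].
have mC : measurable C.
  rewrite -[X in measurable X]setTI.
  exact: measurable_flow_swap.
have := product_measureC_eq0 mu (lebesgue_rV n) mC.
under eq_set do rewrite xsectionE.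
rewrite /preimage/= => ->.
have E t : mu (ysection C t) = 0 <-> mu A = 0.
  have [_ _ _ /(_ A mA)] := flow_nonsingular phi t.
  by rewrite ysectionE.
split=> [A0|].
  rewrite (_ : [set y | _] = set0) ?measure0 //.
  by apply/seteqP; split => // t /=; apply; exact/E.
apply: contraPP => A0; rewrite (_ : [set y | _] = setT).
  exact: lebesgue_rVT_neq0.
by apply/seteqP; split => // t _ /= /E.
Qed.

End flow_null_sets.

(** * Measurable dependence of infima on a parameter *)

Section measurable_inf.
Context {R : realType}.

(** For an upward closed set it suffices to test integers, so the existence of the infimum becomes a
    countable condition. *)
Lemma has_inf_upP (S : set R) : (forall y z, S y -> y <= z -> S z) ->
  has_inf S <-> (exists k : nat, S k%:R) /\ (exists k : nat, ~ S (- k%:R)).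
Proof.
move=> upS; split=> [[[y Sy] [l lS]]|[[k Sk] [m Sm]]].
  split.
    by exists (Num.truncn y).+1; apply: upS Sy _; exact/ltW/truncnS_gt.
  exists (Num.truncn (- l)).+1 => /lS; rewrite leNgt => /negP; apply.
  by rewrite ltrNl truncnS_gt.
split; first by exists k%:R.
exists (- m%:R) => z Sz; rewrite leNgt; apply/negP => zm.
by apply: Sm; exact: upS Sz (ltW zm).
Qed.

Lemma inf_lt_ratP (S : set R) (c : R) : has_inf S ->
  (forall y z, S y -> y <= z -> S z) ->
  inf S < c <-> exists q : rat, S (ratr q) /\ ratr q < c.
Proof.
move=> infS upS; split=> [Sc|[q [Sq qc]]].
  have e0 : 0 < c - inf S by rewrite subr_gt0.
  have [y Sy yc] := inf_adherent e0 infS.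
  rewrite addrC subrK in yc.
  have [q] := rat_in_itvoo yc; rewrite in_itv/= => /andP[yq qc].
  by exists q; split => //; exact: upS Sy (ltW yq).
by apply: le_lt_trans qc; apply: ge_inf => //; exact: infS.2.
Qed.

Lemma measurable_inf_up d (T : measurableType d) (P : T -> set R) :
  (forall x y z, P x y -> y <= z -> P x z) ->
  (forall y, measurable [set x | P x y]) ->
  measurable_fun setT (fun x => inf (P x)).
Proof.
move=> upP mP.
have mD : measurable [set x | has_inf (P x)].
  rewrite (_ : mkset _ = (\bigcup_(k : nat) [set x | P x k%:R]) `&`
     (\bigcup_(k : nat) ~` [set x | P x (- k%:R)])).
    apply: measurableI; apply: bigcupT_measurable => k; first exact: mP.
    exact/measurableC/mP.
  apply/seteqP; split => x /=; first by
    move/(has_inf_upP (upP x)) => [[k Sk] [m Sm]]; split; [exists k|exists m].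
  by move=> [[k _ Sk] [m _ Sm]]; apply/(has_inf_upP (upP x)); split;
    [exists k|exists m].
apply: (measurability _ (RGenInftyO.measurableE R)) => _ [_ [c ->] <-].
(* Where the infimum exists, a rational witness detects [inf < c]; elsewhere [inf] has the default
   value 0, which gives the piece with [0 < c]. *)
rewrite setTI (_ : _ @^-1` _ =
    ([set x | has_inf (P x)] `&`
      \bigcup_(q : rat) ([set x | P x (ratr q)] `&` [set _ | ratr q < c])) `|`
    (~` [set x | has_inf (P x)] `&` [set _ | 0 < c])).
  apply: measurableU; apply: measurableI => //.
  - apply: bigcupT_measurable_rat => q; apply: measurableI => //.
    exact: measurable_set_cst.
  - exact: measurableC.
  - exact: measurable_set_cst.
apply/seteqP; split => x /=; rewrite in_itv/=.
  have [h|h] := pselect (has_inf (P x)); last by rewrite inf_out//; right.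
  by move=> /(inf_lt_ratP c h (upP x)) [q [Pq qc]]; left; split => //; exists q.
move=> [[h [q _ [/= Pq qc]]]|[h c0]]; last by rewrite inf_out.
by apply/(inf_lt_ratP c h (upP x)); exists q.
Qed.

End measurable_inf.

(** * Fundamental domains of the integer lattice *)

Section lattice_tiling.
Context {R : realType} (n : nat).
Implicit Types (m : 'rV[int]_n) (V : set 'rV[R]_n).

Definition lattice m : 'rV[R]_n := map_mx intr m.

Lemma latticeN m : lattice (- m) = - lattice m.
Proof. by rewrite /lattice map_mxN. Qed.

Lemma unit_cube_tiling (v : 'rV[R]_n) : exists m, unit_cube (v - lattice m).
Proof.
exists (map_mx Num.floor v) => i; rewrite !mxE/= in_itv/= subr_ge0 floor_le/=.
by rewrite ltrBlDl -intrD1 floorD1_gt.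
Qed.

Lemma measurable_translate V (s : 'rV[R]_n) :
  measurable V -> measurable [set t | V (t + s)].
Proof.
move=> mV; rewrite -[X in measurable X]setTI.
exact: (measurable_rVD (@measurable_id _ _ setT) (measurable_cst s)).
Qed.

(** The lattice translates of the unit cube cut [V] into countably many pieces. Moved back into the
    cube, these are disjoint by hypothesis, so their total measure is at most that of the cube. *)
Lemma lebesgue_rV_le1 V : measurable V ->
  (forall m m' t, V (t + lattice m) -> V (t + lattice m') -> m = m') ->
  (lebesgue_rV n V <= 1)%E.
Proof.
move=> mV inj; have mC := @measurable_unit_cube R n.
(* [G] lists the pieces in place and [F] the pieces moved into the cube; naturals that code no
   lattice point give empty pieces. *)
pose F k := if @pickle_inv 'rV[int]_n k is Some m
  then [set t | V (t + lattice m) /\ unit_cube t] else set0.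
pose G k := if @pickle_inv 'rV[int]_n k is Some m
  then [set t | V t /\ unit_cube (t - lattice m)] else set0.
have mF k : measurable (F k).
  rewrite /F; case: pickle_inv => // m.
  by apply: measurableI => //; exact: measurable_translate.
have mG k : measurable (G k).
  rewrite /G; case: pickle_inv => // m.
  by apply: measurableI => //; exact: measurable_translate.
have GF k : lebesgue_rV n (G k) = lebesgue_rV n (F k).
  have := mG k; rewrite /G /F; case: pickle_inv => // m mGm.
  rewrite -(lebesgue_rVD (lattice m)) //; congr (lebesgue_rV n _).
  by apply/seteqP; split => t /=; rewrite addrK.
have tF : trivIset setT F.
  move=> i j _ _ [t]; rewrite /F.
  case ei : (pickle_inv i) => [a|]; last by case.
  case ej : (pickle_inv j) => [b|]; last by case.
  move=> [/= [Va _] [Vb _]]; rewrite (inj _ _ _ Va Vb) in ei.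
  have := pickle_invK (T := 'rV[int]_n) i; rewrite ei /= => <-.
  by have := pickle_invK (T := 'rV[int]_n) j; rewrite ej.
rewrite -(@lebesgue_unit_cube R n).
apply: (@le_trans _ _ (\sum_(k <oo) lebesgue_rV n (G k))%E).
  apply: measure_sigma_subadditive => // v Vv.
  have [m Cm] := unit_cube_tiling v.
  by exists (pickle m) => //; rewrite /G pickleK_inv.
rewrite (eq_eseriesr (fun k _ => GF k)) -measure_semi_bigcup //; last first.
  exact: bigcupT_measurable.
apply: le_measure; rewrite ?inE//; first exact: bigcupT_measurable.
by move=> t [k _]; rewrite /F; case: pickle_inv => // m [].
Qed.

(** Were [V] null, its countably many lattice translates together with [N] would make the whole
    space null. *)
Lemma lebesgue_rV_neq0 V (N : set 'rV[R]_n) : measurable V ->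
  measurable N -> lebesgue_rV n N = 0%E ->
  (forall t, N t \/ exists m, V (t + lattice m)) -> lebesgue_rV n V <> 0%E.
Proof.
move=> mV mN N0 cover V0; apply: (@lebesgue_rVT_neq0 R n).
pose F k := if @pickle_inv 'rV[int]_n k is Some m
  then [set t | V (t + lattice m)] else set0.
have mF k : measurable (F k).
  by rewrite /F; case: pickle_inv => // m; exact: measurable_translate.
have -> : [set: 'rV[R]_n] = N `|` \bigcup_k F k.
  apply/seteqP; split => // t _; have [Nt|[m Vm]] := cover t; first by left.
  by right; exists (pickle m) => //; rewrite /F pickleK_inv.
rewrite measureU0 //; first exact: bigcupT_measurable.
apply/measure_negligible; first exact: bigcupT_measurable.
apply: negligible_bigcup => k; apply/negligibleP => //.
rewrite /F; case: pickle_inv => [m|]; last by rewrite measure0.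
by rewrite -[RHS]V0 -(lebesgue_rVD (lattice m)).
Qed.

End lattice_tiling.

(** * Medians of a function on a set of finite measure *)

Section median.
Context {R : realType}.

Lemma inf_shift (S : set R) (c : R) :
  has_inf S -> inf [set y | S (y - c)] = inf S + c.
Proof.
move=> [[y0 Sy0] lS].
have [l lb] := lS.
have n1 : [set y | S (y - c)] !=set0 by exists (y0 + c); rewrite /= addrK.
have b1 : has_lbound [set y | S (y - c)].
  by exists (l + c) => y /= /lb; rewrite lerBrDr.
apply/eqP; rewrite eq_le; apply/andP; split.
  rewrite -lerBlDr; apply: lb_le_inf; first by exists y0.
  by move=> y Sy; rewrite lerBlDr; apply: ge_inf => //=; rewrite addrK.
by apply: lb_le_inf => // y /= Sy; rewrite -lerBrDr; exact: ge_inf.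
Qed.

Context d (T : measurableType d) (mu : {measure set T -> \bar R}).
Variables (V : set T) (u : T -> R).

(** The infimum of this set is the lower median of [u] on [V]. Doubling the sublevel mass avoids
    halving an extended real. *)
Definition above_median : set R :=
  [set y | (mu V <= mu [set t | V t /\ u t <= y]%R +
                    mu [set t | V t /\ u t <= y]%R)%E].

Hypotheses (mV : measurable V) (mu_ : measurable_fun setT u).

Lemma measurable_sublevel y : measurable [set t | V t /\ u t <= y].
Proof.
rewrite (_ : [set t | _] = V `&` (setT `&` u @^-1` `]-oo, y]%classic)).
  by apply: measurableI => //; apply: mu_ => //; exact: measurable_itv.
by rewrite setTI; apply/seteqP; split => t /=; rewrite in_itv.
Qed.

Lemma above_median_up y z : above_median y -> y <= z -> above_median z.
Proof.
rewrite /above_median/= => Vy yz.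
have yz' : (mu [set t | V t /\ u t <= y]%R <= mu [set t | V t /\ u t <= z]%R)%E.
  apply: le_measure; rewrite ?inE; try exact: measurable_sublevel.
  by move=> t /= [Vt uty]; split => //; exact: le_trans yz.
by apply: (le_trans Vy); exact: leeD.
Qed.

(** Sublevel masses tend to [mu V] at [+oo] and to 0 at [-oo], so half of [mu V] is reached at some
    natural [k] and missed at some [- k]. The second limit is continuity from above, which uses
    finiteness. *)
Lemma has_inf_above_median : (0 < mu V)%E -> (mu V < +oo)%E ->
  has_inf above_median.
Proof.
move=> V0 Voo.
have /fineK VE : mu V \is a fin_num by rewrite ge0_fin_numE.
set M := fine (mu V) in VE.
have M0 : 0 < M by rewrite -lte_fin VE.
pose m y := mu [set t | V t /\ u t <= y].
have mfin y : m y \is a fin_num.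
  rewrite ge0_fin_numE//; apply: le_lt_trans Voo.
  apply: le_measure; rewrite ?inE//; first exact: measurable_sublevel.
  by move=> t [].
have half y : above_median y <-> ((M / 2)%:E <= m y)%E.
  rewrite /above_median/= -/(m y) -VE -(fineK (mfin y)) -EFinD !lee_fin.
  by rewrite ler_pdivrMr// mulr_natr mulr2n.
apply/(has_inf_upP above_median_up); split; apply: contrapT => /forallNP H.
- have : (mu (\bigcup_(k : nat) [set t | V t /\ (u t <= k%:R)%R]) <=
      (M / 2)%:E)%E.
    apply: measure_bigcup_le => [k|i j ij|k]; first exact: measurable_sublevel.
      apply/subsetPset => t /= [Vt uti]; split => //.
      by rewrite (le_trans uti)// ler_nat.
    by rewrite leNgt; apply/negP => /ltW/half; exact: H.
  rewrite (_ : \bigcup_k _ = V); last first.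
    apply/seteqP; split => [t [k _ []]//|t Vt].
    by exists (Num.truncn (u t)).+1 => //; split => //; exact/ltW/truncnS_gt.
  rewrite -VE lee_fin leNgt => /negP; apply.
  by rewrite ltr_pdivrMr// mulr_natr mulr2n ltrDl.
- have : ((M / 2)%:E <=
      mu (\bigcap_(k : nat) [set t | V t /\ (u t <= - k%:R)%R]))%E.
    apply: le_measure_bigcap => [k|i j ij||k]; first exact: measurable_sublevel.
    + apply/subsetPset => t /= [Vt uti]; split => //.
      by rewrite (le_trans uti)// lerN2 ler_nat.
    + by rewrite -/(m _) -ge0_fin_numE.
    + by apply: (half _).1; apply: contrapT; exact: H.
  rewrite (_ : \bigcap_k _ = set0) ?measure0; last first.
    apply/seteqP; split => // t /(_ (Num.truncn (- u t)).+1 I) [_].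
    by rewrite leNgt => /negP; apply; rewrite ltrNl truncnS_gt.
  by rewrite lee_fin leNgt divr_gt0.
Qed.

End median.

(** * The equivariant median of the visit times *)

Section visits.
Context {R : realType} (n : nat) d (T : measurableType d).
Variables (mu : {sigma_finite_measure set T -> \bar R}) (phi : nsflow n mu).
Variables (W : set T) (mW : measurable W).

(* The occupation times of [W] form a random measure on [R^n] of mass in
   ]0, 1] which the flow translates; its coordinatewise median is therefore
   an equivariant point, and unlike a mean it needs no integrability. *)
Definition visits (x : T) : set 'rV[R]_n := [set t | W (phi t x)].

Lemma measurable_visits x : measurable (visits x).
Proof.
rewrite -[X in measurable X]setTI.
exact: (measurable_orbit phi x).
Qed.

Lemma measurable_lebesgue_visits :
  measurable_fun setT (fun x => lebesgue_rV n (visits x)).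
Proof.
apply: eq_measurable_fun (measurable_lebesgue_orbit_set phi mW measurableT).
move=> x _; congr (lebesgue_rV n _).
by apply/seteqP; split => t //= -[].
Qed.

Lemma measurable_visits_eq0 :
  measurable [set x | lebesgue_rV n (visits x) = 0%E].
Proof.
rewrite -[X in measurable X]setTI.
exact: (measurable_lebesgue_visits measurableT (emeasurable_set1 0%E)).
Qed.

Lemma visits_flow s x : visits (phi s x) = [set t | visits x (t + s)].
Proof. by apply/seteqP; split => t; rewrite /visits/= flow_mapD. Qed.

Lemma lebesgue_visits_flow s x :
  lebesgue_rV n (visits (phi s x)) = lebesgue_rV n (visits x).
Proof.
rewrite visits_flow -[RHS](lebesgue_rVD s)//; exact: measurable_visits.
Qed.

Definition visit_median (x : T) : 'rV[R]_n :=
  \row_i inf (above_median (lebesgue_rV n) (visits x)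
                           (fun t => - t ord0 i)).

Let measurable_oppcoord (i : 'I_n) :
  measurable_fun setT (fun t : 'rV[R]_n => - t ord0 i).
Proof.
exact: (measurableT_comp (@oppr_measurable R setT) (measurable_coord i)).
Qed.

Lemma measurable_visit_median : measurable_fun setT visit_median.
Proof.
apply/measurable_fun_rVP => i; under eq_fun do rewrite mxE.
apply: measurable_inf_up => [x y z|y].
  apply: above_median_up => //; exact: measurable_visits.
rewrite -[X in measurable X]setTI; apply: measurable_lee => //.
  exact: measurable_lebesgue_visits.
have mB : measurable [set t : 'rV[R]_n | - t ord0 i <= y].
  have := measurable_sublevel measurableT (measurable_oppcoord i) y.
  by rewrite (_ : [set t | _] = [set t : 'rV[R]_n | - t ord0 i <= y])//;
    apply/seteqP; split => t //= -[].
by apply: emeasurable_funD; exact: measurable_lebesgue_orbit_set.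
Qed.

(** The visit times of [phi s x] are those of [x] moved by [- s], so the medians of [- t] move by
    [s]; hence the sign in [visit_median]. The mass bounds ensure genuine infima, since the default
    value 0 would not move. *)
Lemma visit_median_flow s x : (0 < lebesgue_rV n (visits x))%E ->
  (lebesgue_rV n (visits x) < +oo)%E ->
  visit_median (phi s x) = visit_median x + s.
Proof.
move=> V0 Voo; apply/rowP => i; rewrite !mxE -inf_shift; last first.
  by apply: has_inf_above_median => //; exact: measurable_visits.
congr (inf _); apply/seteqP.
suff E y : lebesgue_rV n [set t | visits (phi s x) t /\ - t ord0 i <= y] =
    lebesgue_rV n [set t | visits x t /\ - t ord0 i <= y - s ord0 i].
  by split => y; rewrite /above_median/= lebesgue_visits_flow E.
rewrite -[RHS](lebesgue_rVD s); last first.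
  by apply: measurable_sublevel => //; exact: measurable_visits.
congr (lebesgue_rV n _); rewrite visits_flow.
by apply/seteqP; split => t; rewrite /= !mxE opprD lerD2r.
Qed.

End visits.

(** * The translation flow as a factor of dissipative flows *)

Lemma dissipative_factor {R : realType} (n : nat) d (T : measurableType d)
    (mu : {sigma_finite_measure set T -> \bar R}) (phi : nsflow n mu) :
  mu setT <> 0%E -> totally_dissipative phi ->
  is_factor (translation_flow R n) phi.
Proof.
move=> muT /(_ 1 ltr01) [W [mW dW cW]].
have phi0 x : phi 0 x = x.
  have [/bij_inj phi_inj _ _ _] := flow_nonsingular phi 0.
  by apply: phi_inj; rewrite -flow_mapD addr0.
have phiNK t : cancel (phi t) (phi (- t)) by move=> x; rewrite -flow_mapD addNr.
have phiK t : cancel (phi (- t)) (phi t) by move=> x; rewrite -flow_mapD subrr.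
(* Visits at [t + m] and [t + m'] put [phi t x] into the translates of [W] by [- m] and [- m'],
   which are disjoint unless [m = m']. *)
have V1 x : (lebesgue_rV n (visits phi W x) <= 1)%E.
  apply: lebesgue_rV_le1 => [|m m' t Wm Wm']; first exact: measurable_visits.
  apply/oppr_inj/eqP/negPn/negP => /dW /seteqP[/(_ (phi t x)) + _]; apply.
  split; [exists (phi (t + lattice m) x)|exists (phi (t + lattice m') x)] => //;
    by rewrite -flow_mapD scale1r -/(lattice _) latticeN addrCA addNr addr0.
set U := \bigcup_g _ in cW.
have mU : measurable U.
  apply: countable_bigcupT_measurable => // m.
  by have [_ _ mi _] := flow_nonsingular phi (1 *: lattice m); exact: mi.
have mUC : measurable (~` U) by exact: measurableC.
have mN0 := measurable_visits_eq0 phi mW.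
(* By [flow_null], almost every orbit is outside [U] only for a null set of times; the lattice
   translates of its visit times cover all other times. *)
have ae0 : mu [set x | lebesgue_rV n (visits phi W x) = 0%E] = 0%E.
  move/(flow_null phi mUC) : cW; apply: subset_measure0.
  - exact: mN0.
  - exact: measurableC (measurable_visits_eq0 phi mUC).
  move=> x /= V0 N0; move: V0.
  apply: (lebesgue_rV_neq0 (N := visits phi (~` U) x)) => //.
  - exact: measurable_visits.
  - exact: measurable_visits.
  move=> t; have [Ut|NUt] := pselect (U (phi t x)); last by left.
  right; have [m _ [y Wy]] := Ut; rewrite scale1r -/(lattice _) => yt.
  exists (- m); rewrite /visits/= latticeN addrC flow_mapD -yt phiNK.
  exact: Wy.
have shift x s : lebesgue_rV n (visits phi W x) <> 0%E ->
    visit_median phi W (phi s x) = visit_median phi W x + s.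
  move=> V0; apply: visit_median_flow => //.
    by rewrite lt0e measure_ge0 andbT; exact/eqP.
  by apply: le_lt_trans (V1 x) _; rewrite ltry.
have mm := measurable_visit_median phi mW.
exists (visit_median phi W); split => //.
  (* One exceptional set serves all [s] simultaneously. *)
  exists [set x | lebesgue_rV n (visits phi W x) = 0%E]; split => //.
  by move=> x /= H; apply: contrapT => V0; apply: H => s; exact: shift.
move=> A mA.
have mB : measurable (visit_median phi W @^-1` A).
  by rewrite -[X in measurable X]setTI; exact: mm.
rewrite /pushforward (flow_null phi mB).
(* Along the orbit the median is [t] plus a constant, so by translation invariance the time spent in
   the preimage of [A] does not depend on the orbit. *)
have hitE x : lebesgue_rV n (visits phi W x) <> 0%E ->
    lebesgue_rV n [set t | (visit_median phi W @^-1` A) (phi t x)] =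
    lebesgue_rV n A.
  move=> V0; rewrite -[RHS](lebesgue_rVD (visit_median phi W x))//.
  congr (lebesgue_rV n _); apply/seteqP.
  by split => t /=; rewrite shift// addrC.
have mS := measurableC (measurable_visits_eq0 phi mB).
split=> [S0|A0].
  (* If [A] were not null, every [x] with non-null visits would lie in the null set of [S0]; with
     [ae0] this would make [mu] vanish. *)
  apply: contrapT => A0; apply: muT; rewrite -(setvU [set x |
    lebesgue_rV n (visits phi W x) = 0%E]) measureU0//; last exact: measurableC.
  apply: (subset_measure0 _ mS _ S0) => //; first exact: measurableC.
  by move=> x /= /hitE ->.
apply: (subset_measure0 mS mN0 _ ae0) => // x /= S0; apply: contrapT => /hitE.
by rewrite A0.
Qed.

(** * Quantile functions *)

Section quantile.
Context {R : realType}.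
Local Open Scope ereal_scope.

Lemma measurable_unit_val : measurable_fun setT (@unit_val R : unit_itv R -> R).
Proof.
by move=> _ B mB; rewrite setTI; exists B => //; rewrite setTI.
Qed.

Lemma lebesgue_unitT : lebesgue_unit [set: unit_itv R] = 1.
Proof.
rewrite /lebesgue_unit (_ : _ @` _ = `[0%R, 1%R]%classic).
  by rewrite lebesgue_measure_itv/= lte_fin ltr01 oppr0 adde0.
apply/seteqP; split => [_ [[x x01] _ <-]|x] /=; rewrite in_itv//= => x01.
by exists (exist _ x x01).
Qed.

(** [A] lies between []0, c[] and [[0, c]] with the point 1 added. Nothing is asked at the
    endpoints, where [quantile_le] gives no information. *)
Lemma lebesgue_unit_sublevel (A : set (unit_itv R)) (c : R) :
  (0 <= c <= 1)%R -> measurable A ->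
  (forall z : unit_itv R, (0 < unit_val z < 1)%R ->
    A z <-> (unit_val z <= c)%R) ->
  lebesgue_unit A = c%:E.
Proof.
move=> /andP[c0 c1] mA Ac; have mB := measurable_unit_val_image mA.
have lc (b b' : bool) :
    lebesgue_measure [set` Interval (BSide b 0%R) (BSide b' c)] = c%:E.
  rewrite lebesgue_measure_itv/= lte_fin oppr0 adde0.
  by case: ltP => // c0'; apply/eqP; rewrite eqe eq_le c0.
apply/eqP; rewrite eq_le; apply/andP; split.
  rewrite -(lc true false).
  rewrite -(measureU0 (mu := @lebesgue_measure R) (measurable_itv _)
    (measurable_set1 (1%R : R)) (lebesgue_measure_set1 _)).
  apply: le_measure; rewrite ?inE//.
    by apply: measurableU => //; exact: measurable_itv.
  move=> _ [z Az <-] /=; rewrite in_itv/=.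
  have /andP[z0 z1] : (0 <= unit_val z <= 1)%R by case: (z).
  rewrite z0/=; have [->|zn1] := eqVneq (unit_val z) 1%R; first by right.
  left; have [->//|zn0] := eqVneq (unit_val z) 0%R.
  by move: Az; apply: (Ac _ _).1; rewrite lt0r zn0 z0 lt_neqAle zn1.
rewrite -(lc false true); apply: le_measure; rewrite ?inE//.
move=> z /=; rewrite in_itv/= => /andP[z0 zc].
have z01 : (0 <= z <= 1)%R by rewrite ltW//= (le_trans (ltW zc)).
exists (exist _ z z01) => //; apply/Ac; rewrite /unit_val/= ?ltW//.
by rewrite z0 (lt_le_trans zc).
Qed.

Variable P : probability (measurableTypeR R) R.

Definition quantile (z : unit_itv R) : R :=
  inf [set y | (unit_val z)%:E <= P `]-oo, y]%classic].

Let P_le y z : (y <= z)%R -> P `]-oo, y]%classic <= P `]-oo, z]%classic.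
Proof. by move=> yz; apply: le_measure; rewrite ?inE//; exact: subset_itvl. Qed.

Lemma measurable_quantile : measurable_fun setT quantile.
Proof.
apply: measurable_inf_up => [z x y zx xy|y].
  exact: (le_trans zx) (P_le xy).
rewrite -[X in measurable X]setTI; apply: measurable_lee => //.
exact/measurable_EFinP/measurable_unit_val.
Qed.

(** The distribution function tends to 0 and 1 at the two ends, so the infimum exists; right
    continuity, i.e. continuity of [P] from above, shows that it is attained. *)
Lemma quantile_le (z : unit_itv R) (y : R) : (0 < unit_val z < 1)%R ->
  (quantile z <= y)%R <-> (unit_val z)%:E <= P `]-oo, y]%classic.
Proof.
move=> /andP[z0 z1].
have infS : has_inf [set y | (unit_val z)%:E <= P `]-oo, y]%classic].
  apply/has_inf_upP => [x x' zx xx'|]; first exact: (le_trans zx) (P_le xx').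
  split; apply: contrapT => /forallNP H.
  - have : P (\bigcup_(k : nat) `]-oo, k%:R]%classic) <= (unit_val z)%:E.
      apply: measure_bigcup_le => [k|i j ij|k]; first exact: measurable_itv.
        by apply/subsetPset/subset_itvl; rewrite bnd_simp ler_nat.
      by rewrite leNgt; apply/negP => /ltW; exact: H.
    rewrite (_ : \bigcup_k _ = setT) ?probability_setT ?lee_fin ?leNgt ?z1//.
    apply/seteqP; split => // x _; exists (Num.truncn x).+1 => //=.
    by rewrite in_itv/=; exact/ltW/truncnS_gt.
  - have : (unit_val z)%:E <= P (\bigcap_(k : nat) `]-oo, (- k%:R)%R]%classic).
      apply: le_measure_bigcap => [k|i j ij||k]; first exact: measurable_itv.
      + by apply/subsetPset/subset_itvl; rewrite bnd_simp lerN2 ler_nat.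
      + by rewrite (le_lt_trans (probability_le1 _ _)) ?ltry.
      + by apply: contrapT; exact: H.
    rewrite (_ : \bigcap_k _ = set0) ?measure0 ?lee_fin ?leNgt ?z0//.
    apply/seteqP; split => // x /(_ (Num.truncn (- x)%R).+1 I) /=.
    by rewrite in_itv/= leNgt => /negP; apply; rewrite ltrNl truncnS_gt.
split=> [zy|]; last by apply: ge_inf; exact: infS.2.
apply: le_trans (P_le zy); rewrite (itvNycEbigcap false).
apply: le_measure_bigcap => [k|i j ij||k]; first exact: measurable_itv.
- apply/subsetPset/subset_itvl; rewrite bnd_simp lerD2l.
  by rewrite lef_pV2 ?posrE// ler_nat.
- by rewrite (le_lt_trans (probability_le1 _ _)) ?ltry.
have e0 : (0 < k.+1%:R^-1 :> R)%R by rewrite invr_gt0.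
have [x /= zx xk] := inf_adherent e0 infS.
exact: le_trans zx (P_le (ltW xk)).
Qed.

(** Two measures of mass 1 that agree on the rays []x, +oo[], a generating class stable under
    intersection, are equal. Complements reduce this to the rays []-oo, x]], handled by
    [quantile_le]. *)
Lemma lebesgue_unit_quantile (A : set R) : measurable A ->
  lebesgue_unit (quantile @^-1` A) = P A.
Proof.
have mQ := measurable_quantile.
have mpre (B : set R) : measurable B -> measurable (quantile @^-1` B).
  by move=> mB; rewrite -[X in measurable X]setTI; exact: mQ.
pose Q := measure_function_pushforward__canonical__measure_function_Measure
  lebesgue_unit
  (mQ : measurable_fun setT (quantile : unit_itv R -> measurableTypeR R)).
have fin (m : {measure set (measurableTypeR R) -> \bar R}) B :
    m setT = 1 -> measurable B -> m (~` B) = 1 - m B.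
  move=> m1 mB; rewrite -m1 -(setvU B) measureU//; last 2 first.
    exact: measurableC.
    exact: setICl.
  rewrite addeK// ge0_fin_numE//; apply: (@le_lt_trans _ _ (m setT)).
    by apply: le_measure; rewrite ?inE.
  by rewrite m1 ltry.
have Q1 : Q setT = 1 by rewrite /Q/= /pushforward preimage_setT lebesgue_unitT.
have P1 : P setT = 1 by exact: probability_setT.
move=> mA; rewrite -[LHS]/(Q A); 
apply: (@measure_unique _ R (measurableTypeR R) (@RGenOInfty.G R)
  (fun k : nat => `](- k%:R)%R, +oo[%classic)) => //.
- exact: RGenOInfty.measurableE.
- move=> _ _ [x ->] [y ->]; exists (Num.max x y); apply/seteqP.
  split => t /=; rewrite !in_itv/= !andbT gt_max; last by move/andP.
  by move=> [-> ->].
- by move=> k; exists (- k%:R)%R.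
- apply/seteqP; split => // x _; exists (Num.truncn (- x)%R).+1 => //=.
  by rewrite in_itv/= andbT ltrNl truncnS_gt.
- move=> _ [x ->]; rewrite -setCitvl !fin//; try exact: measurable_itv.
  congr (1 - _); transitivity (fine (P `]-oo, x]%classic))%:E; last first.
    by rewrite fineK ?fin_num_measure.
  apply: lebesgue_unit_sublevel.
  + by rewrite fine_ge0//= -lee_fin fineK ?fin_num_measure// probability_le1.
  + by apply: mpre; exact: measurable_itv.
  + move=> z z01; rewrite /= in_itv/=.
    rewrite -[(unit_val z <= _)%R]lee_fin fineK ?fin_num_measure//.
    exact: quantile_le.
- move=> k; apply: (@le_lt_trans _ _ (Q setT)); last by rewrite Q1 ltry.
  by apply: le_measure; rewrite ?inE//; exact: measurable_itv.
Qed.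

End quantile.

(** * An equivalent probability measure *)

Section equivalent_probability.
Context {R : realType} d (T : measurableType d).
Local Open Scope ereal_scope.

Lemma null_equiv_probability (mu : {sigma_finite_measure set T -> \bar R}) :
  mu setT <> 0 -> exists P : probability T R, null_equiv P mu.
Proof.
move=> muT.
have [F FT Foo] := sigma_finiteT mu.
have mF k := (Foo k).1.
have Ffin k : mu (F k) \is a fin_num by rewrite ge0_fin_numE// (Foo k).2.
(* This bounds the [k]-th term of [nu] by [2^-(k+1)], hence the total mass by 1; the summand 1 keeps
   the denominator positive when [mu (F k) = 0]. *)
pose w k : R := (((2 ^ k.+1)%:R * (1 + fine (mu (F k))))^-1)%R.
have w0 k : (0 < w k)%R.
  by rewrite invr_gt0 mulr_gt0// ?ltr0n ?expn_gt0// ltr_pwDl// fine_ge0.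
pose nu := mseries (fun k => mscale (NngNum (ltW (w0 k))) (mrestr mu (mF k))) 0.
have nuE A : nu A = \sum_(k <oo) ((w k)%:E * mu (A `&` F k)) by [].
have t0 A k : 0 <= (w k)%:E * mu (A `&` F k) by rewrite mule_ge0// lee_fin ltW.
have nu_null : null_equiv nu mu.
  move=> A mA; rewrite nuE; split=> [nu0|A0].
    have F0 k : mu (A `&` F k) = 0.
      have : (w k)%:E * mu (A `&` F k) <= 0.
        rewrite -nu0; apply: le_trans (nneseries_lim_ge k.+1 _) => //.
        by rewrite big_nat_recr//= leeDr// sume_ge0.
      by rewrite pmule_rle0 ?lte_fin// measure_le0 => /eqP.
    have -> : A = \bigcup_k (A `&` F k) by rewrite -setI_bigcupr -FT setIT.
    apply/measure_negligible.
      by apply: bigcupT_measurable => k; exact: measurableI.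
    apply: negligible_bigcup => k; apply/negligibleP; last exact: F0.
    exact: measurableI.
  rewrite eseries0// => k _ _; rewrite (subset_measure0 _ mA _ A0) ?mule0//.
  exact: measurableI.
have nuT1 : nu setT <= 1.
  apply: le_trans (epsilon_trick0 (fun=> true) (@ler01 R)).
  rewrite nuE; apply: lee_nneseries => // k _; rewrite setTI.
  rewrite -(fineK (Ffin k)) -EFinM lee_fin /w invfM div1r -mulrA.
  rewrite ler_piMr ?invr_ge0 ?ler0n// ler_pdivrMl ?mulr1 ?lerDr//.
  by rewrite ltr_pwDl// fine_ge0.
have nuTfin : nu setT \is a fin_num.
  by rewrite ge0_fin_numE ?(le_lt_trans nuT1) ?ltry// nuE nneseries_ge0.
have nuT0 : nu setT <> 0 by move/(nu_null _ measurableT).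
(* [dirac point] is only the fallback for mass 0 or [+oo], excluded by [nuT0] and [nuT1]. *)
exists (mnormalize nu (dirac point)) => A mA; rewrite -(nu_null A mA).
have c0 : (fine (nu setT))^-1%:E <> 0.
  by move=> /eqP; rewrite eqe invr_eq0 fine_eq0// => /eqP.
have PE : mnormalize nu (dirac point) A = nu A * (fine (nu setT))^-1%:E.
  rewrite /mnormalize; case: ifPn => [/orP[/eqP//|/eqP nuToo]|//].
  by have := le_lt_trans nuT1 (ltry 1); rewrite [X in X < _]nuToo.
split=> [PA0|nuA0]; last by apply: (etrans PE); rewrite nuA0 mul0e.
by have /eqP := etrans (esym PE) PA0; rewrite mule_eq0 => /orP[/eqP//|/eqP].
Qed.

End equivalent_probability.

(** * Real codes for sequences of sets *)

Section coding.
Context {R : realType}.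

(** The sum of [b i / 3^i] over [i < n], in Horner form so that dropping the first digit is
    structural. Digits 0 and 1 in base 3 leave gaps, which make the expansion unambiguous. *)
Fixpoint ternary_sum (b : nat -> bool) (n : nat) : R :=
  if n is m.+1 then (b 0%N)%:R + ternary_sum (b \o succn) m / 3 else 0.

Lemma ternary_sum_bounds b n : 0 <= ternary_sum b n <= 3 / 2.
Proof.
elim: n b => [|n IH] b /=; first by rewrite lexx divr_ge0.
have /andP[] := IH (b \o succn); case: (b 0%N) => /=; lra.
Qed.

Lemma ternary_sum_nondecreasing b : nondecreasing_seq (ternary_sum b).
Proof.
apply/nondecreasing_seqP => n; elim: n b => [|n IH] b.
  by have /andP[] := ternary_sum_bounds b 1.
rewrite [leLHS]/= [leRHS]/= lerD2l ler_pM2r ?invr_gt0//; exact: IH.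
Qed.

Definition ternary (b : nat -> bool) : R := limn (ternary_sum b).

Lemma cvg_ternary_sum b : ternary_sum b @ \oo --> ternary b.
Proof.
apply: nondecreasing_is_cvgn; first exact: ternary_sum_nondecreasing.
by exists (3 / 2) => _ [n _ <-]; have /andP[] := ternary_sum_bounds b n.
Qed.

Lemma ternary_bounds b : 0 <= ternary b <= 3 / 2.
Proof.
have cb := @cvg_ternary_sum b; apply/andP; split.
  apply: limr_ge; first exact: cb.
  by apply: nearW => n; have /andP[] := ternary_sum_bounds b n.
apply: limr_le; first exact: cb.
by apply: nearW => n; have /andP[] := ternary_sum_bounds b n.
Qed.

Lemma ternary_rec b : ternary b = (b 0%N)%:R + ternary (b \o succn) / 3.
Proof.
have c1 : (b 0%N)%:R + ternary_sum (b \o succn) n / 3 @[n --> \oo] -->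
    (b 0%N)%:R + ternary (b \o succn) / 3.
  apply: cvgD; first exact: cvg_cst.
  by apply: cvgM; [exact: cvg_ternary_sum|exact: cvg_cst].
have c2 : ternary_sum b n.+1 @[n --> \oo] --> ternary b.
  by rewrite (cvg_shiftS (ternary_sum b)); exact: cvg_ternary_sum.
exact: (cvg_unique _ c2 c1).
Qed.

(** All later digits together contribute at most [(3 / 2) / 3 = 1 / 2]. *)
Lemma ternary_ge1 b : (1 <= ternary b) = b 0%N.
Proof.
have /andP[] := ternary_bounds (b \o succn); rewrite (ternary_rec b).
case: (b 0%N) => /= b0 b1; first by rewrite lerDl divr_ge0.
by apply/negbTE; rewrite -ltNge add0r; lra.
Qed.

(** On codes this is the left shift of digits; as a Borel map of the whole line it makes each digit
    test a Borel set. *)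
Definition ternary_shift (y : R) : R := 3 * (y - (1 <= y)%R%:R).

Lemma iter_ternary_shift j b :
  iter j ternary_shift (ternary b) = ternary (fun i => b (j + i)%N).
Proof.
elim: j => //= j ->; rewrite /ternary_shift ternary_ge1 addn0.
rewrite [X in 3 * (X - _)]ternary_rec addn0 addrC addKr mulrC divfK//.
by congr ternary; apply/funext => i /=; rewrite addnS.
Qed.

Lemma measurable_iter_ternary_shift j :
  measurable_fun setT (iter j ternary_shift).
Proof.
elim: j => [|j IH]; first exact: measurable_id.
suff ms : measurable_fun setT ternary_shift by exact: (measurableT_comp ms IH).
apply: measurable_funM => //; apply: measurable_funB => //.
rewrite (_ : (fun y => _) = (fun y : R => if 1 <= y then 1 else 0)); last first.
  by apply/funext => y; case: ifP.
apply: measurable_fun_ifT => //.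
exact: measurable_fun_ler.
Qed.

Lemma measurable_ternary d (T : measurableType d) (A : (set T)^nat) :
  (forall j, measurable (A j)) ->
  measurable_fun setT (fun x => ternary (fun j => `[< A j x >])).
Proof.
move=> mA; apply: (measurable_fun_cvg
    (h := fun n x => ternary_sum (fun j => `[< A j x >]) n)) => [n|x _].
  elim: n A mA => [|n IH] A mA /=; first exact: measurable_cst.
  apply: measurable_funD; last first.
    by apply: measurable_funM => //; apply: (IH (A \o succn)) => j; exact: mA.
  rewrite (_ : (fun x => _) = \1_(A 0%N)); first exact: measurable_indic.
  by apply/funext => x; rewrite indicE.
exact: cvg_ternary_sum.
Qed.

(* The ternary digits of [g x] record the sets [A j] containing [x]. *)
Lemma marczewski_function d (T : measurableType d) (A : (set T)^nat) :
  (forall j, measurable (A j)) ->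
  exists (g : T -> R) (E : (set R)^nat), [/\ measurable_fun setT g,
    forall j, measurable (E j) & forall j, g @^-1` E j = A j].
Proof.
move=> mA; exists (fun x => ternary (fun j => `[< A j x >])).
exists (fun j => [set y | 1 <= iter j ternary_shift y]); split=> [|j|j].
- exact: measurable_ternary.
- rewrite -[X in measurable X]setTI.
  rewrite (_ : [set y | _] = iter j ternary_shift @^-1` `[1, +oo[%classic).
    by apply: measurable_iter_ternary_shift => //; exact: measurable_itv.
  by apply/seteqP; split => y /=; rewrite in_itv/= andbT.
- apply/seteqP; split => x /=; rewrite iter_ternary_shift ternary_ge1 addn0;
  by move/asboolP.
Qed.

End coding.

(** * Decoding into a Polish space *)

Lemma second_countable_seq (P : topologicalType) : @second_countable P ->
  exists U : (set P)^nat, (forall j, open (U j)) /\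
    forall p O, nbhs p O -> exists j, U j p /\ U j `<=` O.
Proof.
move=> [B /countable_injP[h hinj] [Bopen Bbase]].
(* Indices missed by the enumeration get the default [setT], which is open. *)
exists (fun j => xget setT [set V | B V /\ h V = j]); split=> [j|p O pO].
  by case: xgetP => [V _ [/Bopen]//|_]; exact: openT.
have [V [BV Vp] VO] := Bbase p O pO.
exists (h V); case: xgetP => [V' _ [BV' hV']|/(_ V) []//].
by rewrite (hinj _ _ _ _ hV') ?inE.
Qed.

Section retraction.
Context {R : realType} (P : completePseudoMetricType R) (d : measure_display)
  (S : measurableType d).
Variables (U : (set P)^nat) (E : (set S)^nat).
Hypotheses (hP : hausdorff_space P) (oU : forall j, open (U j))
  (bU : forall p O, nbhs p O -> exists j, U j p /\ U j `<=` O)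
  (mE : forall j, measurable (E j)).

(* [E j] collects the codes of the points of [U j].  A code is readable when
   the sets it selects form a base of a proper Cauchy filter; this is a
   countable Boolean condition, so that no Lusin-Souslin theorem is needed. *)
Definition code_filter (y : S) : set_system P :=
  filter_from [set j | E j y] U.

Definition readable (y : S) : Prop :=
  [/\ forall n : nat, exists j, E j y /\
        exists p, U j `<=` ball p (n.+1%:R^-1 : R),
      forall j, E j y -> U j !=set0 &
      forall i j, E i y -> E j y -> exists k, E k y /\ U k `<=` U i `&` U j].

Lemma measurable_readable : measurable [set y | readable y].
Proof.
have mc (Q : Prop) : measurable [set _ : S | Q] by exact: measurable_set_cst.
have mi (A B : set S) : measurable A -> measurable B ->
    measurable [set y | A y -> B y].
  move=> mA mB; rewrite (_ : [set y | _] = ~` A `|` B).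
    by apply: measurableU => //; exact: measurableC.
  apply/seteqP; split => y /=; last by case.
  by move=> AB; have [/AB|] := pselect (A y); [right|left].
have mall (F : (set S)^nat) : (forall j, measurable (F j)) ->
    measurable [set y | forall j, F j y].
  move=> mF; rewrite (_ : [set y | _] = \bigcap_j F j).
    exact: bigcapT_measurable.
  by apply/seteqP; split => y /= H; move=> j; [move=> _|]; exact: H.
have mex (F : (set S)^nat) : (forall j, measurable (F j)) ->
    measurable [set y | exists j, F j y].
  move=> mF; rewrite (_ : [set y | _] = \bigcup_j F j).
    exact: bigcupT_measurable.
  by apply/seteqP; split => y /= [j]; [exists j|move=> _ Fj; exists j].
rewrite (_ : [set y | _] = [set y | forall n : nat, exists j, (E j `&`
    [set _ | exists p, U j `<=` ball p (n.+1%:R^-1 : R)]) y] `&`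
  ([set y | forall j, E j y -> U j !=set0] `&`
  [set y | forall i j, E i y -> E j y -> exists k, (E k `&`
    [set _ | U k `<=` U i `&` U j]) y])); last first.
  by apply/seteqP; split => y; [move=> []|move=> [? []]].
apply: measurableI; [|apply: measurableI].
- by apply: mall => n; apply: mex => j; exact: measurableI.
- by apply: mall => j; apply: (mi (E j) [set _ | U j !=set0]).
- apply: (mall _) => i; apply: (mall _) => j.
  pose D := [set y | exists k, (E k `&` [set _ | U k `<=` U i `&` U j]) y].
  apply: (mi (E i) [set y | E j y -> D y]) => //; apply: (mi (E j) D) => //.
  by apply: mex => k; exact: measurableI.
Qed.

Lemma code_filter_proper y : readable y -> ProperFilter (code_filter y).
Proof.
move=> [small nonempty directed].
apply: filter_from_proper; last exact: nonempty.
apply: filter_from_filter => [|i j Ei Ej].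
  by have [j [Ej _]] := small 0%N; exists j.
by have [k [Ek]] := directed i j Ei Ej; exists k.
Qed.

Lemma code_filter_cvg y : readable y -> cvg (code_filter y).
Proof.
move=> ry; have PF := code_filter_proper ry.
apply/cauchy_cvgP/cauchyP => e e0; have [small _ _] := ry.
(* With this index the radius [1 / (n + 1)] is at most [e]. *)
have [j [Ej [p Up]]] := small (Num.truncn e^-1).
exists p, j => // q /Up; apply: le_ball.
by rewrite invf_ple ?posrE// ltW// truncnS_gt.
Qed.

Definition read (y : S) : P :=
  if `[< readable y >] then lim (code_filter y) else point.

(** The limit lies in the closure of every set of the filter; conversely, regularity puts a closed
    neighbourhood of it inside [O]. The preimage of [O] among readable codes is thus a countable
    union of sets [E j]. *)
Lemma read_openP y O : readable y -> open O ->
  O (read y) <-> exists j, E j y /\ closure (U j) `<=` O.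
Proof.
move=> ry oO; have PF := code_filter_proper ry; have cF := code_filter_cvg ry.
have -> : read y = lim (code_filter y) by rewrite /read asboolT.
split=> [Oy|[j [Ej UO]]].
  have [V nV VO] := uniform_regular (open_nbhs_nbhs (conj oO Oy)).
  have [j Ej UV] := cF _ nV; exists j; split => //.
  by apply: subset_trans VO; exact: closureS.
apply: UO => B nB; have FB := cF _ nB.
have FU : code_filter y (U j) by exists j.
exact: (@filter_ex _ _ PF _ (filterI FU FB)).
Qed.

Lemma measurable_read (C : set P) : <<s @open P >> C ->
  measurable (read @^-1` C).
Proof.
suff : <<s @open P >> `<=` [set C | measurable (read @^-1` C)] by apply.
apply: smallest_sub => [|O oO].
  split => [|A mA|F mF] /=.
  - by rewrite preimage_set0.
  - by rewrite setTD preimage_setC; exact: measurableC.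
  - by rewrite preimage_bigcup; exact: bigcupT_measurable.
have mr := measurable_readable.
rewrite /= (_ : _ @^-1` _ =
  ([set y | readable y] `&`
    \bigcup_(j in [set j | closure (U j) `<=` O]) E j) `|`
  (~` [set y | readable y] `&` [set _ | O point])).
  apply: measurableU; apply: measurableI => //.
  - exact: bigcup_measurable.
  - exact: measurableC.
  - exact: measurable_set_cst.
apply/seteqP; split => y /=.
  have [ry|nry] := pselect (readable y).
    move=> /(read_openP ry oO)[j [Ej UO]]; left; split => //.
    by exists j.
  by rewrite /read asboolF//; right.
move=> [[ry [j /= UO Ej]]|[nry Op]]; last by rewrite /read asboolF.
by apply/(read_openP ry oO); exists j.
Qed.

(** Such a code selects exactly the basic sets around [p], so its filter converges to [p], and
    limits are unique by [hP]. *)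
Lemma read_code (y : S) (p : P) : (forall j, E j y <-> U j p) -> read y = p.
Proof.
move=> Ep.
have ry : readable y.
  split=> [n|j /Ep Uj|i j /Ep Ui /Ep Uj]; last 2 first.
  - by exists p.
  - have [k [Uk UO]] :=
      bU (open_nbhs_nbhs (conj (openI (oU i) (oU j)) (conj Ui Uj))).
    by exists k; split => //; exact/Ep.
  have n0 : 0 < n.+1%:R^-1 :> R by rewrite invr_gt0.
  have [j [Uj UO]] := bU (nbhsx_ballx p _ n0).
  by exists j; split; [exact/Ep|exists p].
have PF := code_filter_proper ry.
rewrite /read asboolT//.
apply: (cvg_lim (F := code_filter y) hP) => O /bU [j [Uj UO]].
by exists j => //; exact/Ep.
Qed.

End retraction.

(** * Universality of the canonical translation flow *)

Lemma standard_lebesgue_image {R : realType} d (T : measurableType d)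
    (P : probability T R) : standard_space R T ->
  exists h : unit_itv R -> T, measurable_fun setT h /\
    forall A, measurable A -> lebesgue_unit (h @^-1` A) = P A.
Proof.
move=> [Po [f [hP /second_countable_seq[U [oU bU]] [finv fK finvK] mT]]].
have mf C : <<s @open Po >> C -> measurable (f @^-1` C).
  by move=> sC; rewrite mT; exists C => //; rewrite setTI.
have [g [E [mg mE gE]]] := @marczewski_function R _ _ (fun j => f @^-1` U j)
  (fun j => mf _ (@sub_sigma_algebra _ setT open _ (oU j))).
pose r := finv \o @read R Po _ _ U E.
have mr : measurable_fun setT r.
  move=> _ B; rewrite mT => -[C sC <-]; rewrite !setTI.
  rewrite (_ : r @^-1` _ = @read R Po _ _ U E @^-1` C).
    exact: measurable_read.
  by apply/seteqP; split => y; rewrite /r/= finvK.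
have rg x : r (g x) = x.
  rewrite /r/= (@read_code R Po _ _ U E hP oU bU (g x) (f x)) ?fK// => j.
  by rewrite -[U j (f x)]/((f @^-1` U j) x) -gE.
pose X : {mfun T >-> measurableTypeR R} :=
  @mfun_Sub _ _ T (measurableTypeR R) g (mem_set mg).
have mQ := measurable_quantile (distribution P X).
(* The quantile function produces the law of the coding [g] under [P], and [r] carries it back to
   [P] because [r (g x) = x]. *)
exists (r \o quantile (distribution P X)); split.
  exact: (measurableT_comp mr mQ).
move=> A mA; rewrite comp_preimage lebesgue_unit_quantile.
  rewrite /distribution/pushforward /=.
  by congr (P _); apply/seteqP; split => x /=; rewrite rg.
by rewrite -[X in measurable X]setTI; exact: mr.
Qed.

Lemma canonical_factor {R : realType} (n : nat) d (T : measurableType d)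
    (mu : {sigma_finite_measure set T -> \bar R}) (phi : nsflow n mu) :
  standard_space R T -> mu setT <> 0%E ->
  is_factor phi (canonical_translation_flow R n).
Proof.
move=> sT /null_equiv_probability[P Pmu].
have [h [mh hP]] := standard_lebesgue_image P sT.
have mpi : measurable_fun setT
    (fun p : unit_itv R * 'rV[R]_n => phi p.2 (h p.1)).
  have mp : measurable_fun setT
      (fun p : unit_itv R * 'rV[R]_n => (p.2, h p.1)).
    by apply: measurable_fun_pair => //; exact: measurableT_comp.
  exact: (measurableT_comp (flow_measurable phi) mp).
exists (fun p => phi p.2 (h p.1)); split => //.
  by apply: aeW => p s /=; rewrite -flow_mapD addrC.
move=> A mA; have mN := measurableC (measurable_visits_eq0 phi mA).
(* Nullity of [A] becomes a condition on Lebesgue-almost every [z], the one that Fubini gives for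
   the preimage of [A] in the product. *)
rewrite (flow_null phi mA) -(Pmu _ mN) -(hP _ mN).
have mB : measurable
    ((fun p : unit_itv R * 'rV[R]_n => phi p.2 (h p.1)) @^-1` A).
  by rewrite -[X in measurable X]setTI; exact: mpi.
rewrite /pushforward /= /product_measure1.
rewrite integral_eq0P //; last exact: measurable_fun_xsection.
rewrite (_ : [set x | _] =
  h @^-1` (~` [set x | lebesgue_rV n (visits phi A x) = 0%E])) //.
by apply/seteqP; split => z /=; rewrite xsectionE.
Qed.

Theorem theorem2p5 (R : realType) (d : nat) (hd : (1 <= d)%N) :
  (forall (disp : measure_display) (T : measurableType disp)
      (mu : {sigma_finite_measure set T -> \bar R}) (phi : nsflow d mu),
    standard_space R T -> (0 < mu setT)%E ->
    is_factor phi (canonical_translation_flow R d)) /\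
  (forall (disp : measure_display) (T : measurableType disp)
      (mu : {sigma_finite_measure set T -> \bar R}) (phi : nsflow d mu),
    standard_space R T -> (0 < mu setT)%E -> nonatomic mu ->
    totally_dissipative phi ->
    is_factor (translation_flow R d) phi).
Proof.
split=> disp T mu phi sT muT; last move=> _.
  by apply: canonical_factor => //; move: muT; rewrite lt0e => /andP[/eqP].
by apply: dissipative_factor; move: muT; rewrite lt0e => /andP[/eqP].
Qed.
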